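(* For a zero-dimensional Tychonoff space $X$ the following assertions are equivalent: (1) $C_p(X,\mathbb{Q})$ is S-separable; (2) $C_p(X,\mathbb{Q})$ is M-separable; (3) $C_p(X,\mathbb{Z})$ is S-separable; (4) $C_p(X,\mathbb{Z})$ is M-separable; (5) $C_p(X,2)$ is S-separable; (6) $C_p(X,2)$ is M-separable; (7) $iw(X)=\omega$ and every finite power of $X$ is Menger.
   Context: A space is zero-dimensional if it has a base of clopen sets. For a space $E$, $C_p(X,E)$ is the set of continuous functions $X\to E$ with the topology of pointwise convergence; $\mathbb{Q}$ and $\mathbb{Z}$ carry the usual topologies inherited from $\mathbb{R}$ and $2=\{0,1\}$ is discrete. A space $Z$ is S-separable if for every sequence $(Y_n)_{n\in\mathbb{N}}$ of dense subspaces of $Z$ there exists a sequence $(F_n)$ such that each $F_n$ is a finite subset of $Y_n$ and for each finite collection $\mathcal{F}$ of nonempty open sets of $Z$ there exists $n$ with $U\cap F_n\neq\emptyset$ for all $U\in\mathcal{F}$. $Z$ is M-separable if for every sequence $(Y_n)$ of dense subspaces of $Z$ there exists a sequence $(F_n)$ with each $F_n$ a finite subset of $Y_n$ and $\bigcup_n F_n$ dense in $Z$. $iw(X)$ is the least weight of a Tychonoff topology on $X$ contained in the topology of $X$; with the usual convention that cardinal functions take infinite values, $iw(X)=\omega$ means that $X$ has a coarser Tychonoff topology with a countable base. A space $Z$ is Menger if for every sequence $(\mathcal{U}_n)$ of open covers of $Z$ there are finite $\mathcal{V}_n\subseteq\mathcal{U}_n$ such that $\bigcup_n\mathcal{V}_n$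 covers $Z$. *)

(* Defs.v *)
From HB Require Import structures.
From mathcomp Require Import all_boot all_order all_algebra.
From mathcomp Require Import all_classical all_reals all_analysis.

Set Implicit Arguments.
Unset Strict Implicit.
Unset Printing Implicit Defensive.

Import Order.TTheory GRing.Theory Num.Theory.
Import numFieldNormedType.Exports.

Local Open Scope classical_set_scope.
Local Open Scope ring_scope.

Definition tychonoff_space (X : topologicalType) : Prop :=
  hausdorff_space X /\ completely_regular_space X.

(* The library's [zero_dimensional] is weaker: it only says that distinct
   points are separated by clopen sets. *)
Definition has_clopen_base (X : topologicalType) : Prop :=
  exists2 B : set (set X), B `<=` clopen & basis B.

(* [{ptws X -> E}] is the full product; the continuous functions get the
   subspace topology. *)
Definition Cp (X E : topologicalType) : topologicalType :=
  initial_topology (fun f : continuousType X E => (f : {ptws X -> E})).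

Definition Qtop (R : realType) : topologicalType :=
  initial_topology (ratr : rat -> R).

Definition Ztop (R : realType) : topologicalType :=
  initial_topology (intr : int -> R).

Definition S_separable (Z : topologicalType) : Prop :=
  forall Y : nat -> set Z, (forall n, dense (Y n)) ->
  exists F : nat -> set Z,
    (forall n, finite_set (F n) /\ F n `<=` Y n) /\
    (forall G : set (set Z), finite_set G ->
       (forall U, G U -> open U /\ U !=set0) ->
       exists n, forall U, G U -> U `&` F n !=set0).

Definition M_separable (Z : topologicalType) : Prop :=
  forall Y : nat -> set Z, (forall n, dense (Y n)) ->
  exists F : nat -> set Z,
    (forall n, finite_set (F n) /\ F n `<=` Y n) /\
    dense (\bigcup_n F n).

Definition open_cover (Z : topologicalType) (U : set (set Z)) : Prop :=
  U `<=` open /\ \bigcup_(A in U) A = setT.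

Definition menger (Z : topologicalType) : Prop :=
  forall U : nat -> set (set Z), (forall n, open_cover (U n)) ->
  exists V : nat -> set (set Z),
    (forall n, finite_set (V n) /\ V n `<=` U n) /\
    \bigcup_n \bigcup_(A in V n) A = setT.

(* [iw X = omega]. As cardinal functions take infinite values, this amounts to
   the minimum defining [iw X] being attained at a countable weight. [t] is a
   topology on the carrier of [X]. *)
Definition iw_eq_omega (X : topologicalType) : Prop :=
  exists t : Topological.axioms_ X,
    let X' : topologicalType := Topological.Pack t in
    [/\ (forall A : set X, @open X' A -> @open X A),
        tychonoff_space X' & @second_countable X'].

(* Main.v *)
(* If C_p(X, E) is M-separable and W is a proper nonempty clopen subset of E,
   then the preimages of W under a countable dense set of functions are clopen
   sets separating the points of X, whence iw(X) = omega. Given open covers U_k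
   of X^n, the functions f such that f^-1(W)^n is covered by finitely many
   members of U_k form a dense set; as the functions mapping all coordinates of
   a given point into W form a nonempty open set, M-separability applied to
   these dense sets gives the Menger property of X^n.

   Conversely, X^2 being Menger and the complement of the diagonal being
   F_sigma (iw(X) = omega), countably many clopen sets separate the points of X,
   so there is a countable family D of locally constant functions which agrees
   on each finite set with any given function. For a finite part of D, a
   precision and a length k, approximating this part of D by members of the
   dense set Y_n at the coordinates of a point yields an open cover of X^k, and
   the Menger property of X^k selects the required finite subsets of Y_n. *)

Require Import Defs.
From HB Require Import structures.
From mathcomp Require Import all_boot all_order all_algebra.
From mathcomp Require Import all_classical all_reals all_analysis.
From mathcomp Require Import lra.

Set Implicit Arguments.
Unset Strict Implicit.
Unset Printing Implicit Defensive.

Import Order.TTheory GRing.Theory Num.Theory.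
Import numFieldNormedType.Exports.

Local Open Scope classical_set_scope.
Local Open Scope ring_scope.

(** * Neighbourhoods and density in the topology of pointwise convergence *)

Lemma near_all (T : topologicalType) (I : eqType) (p : T) (s : seq I)
    (A : I -> set T) :
  (forall i, i \in s -> nbhs p (A i)) ->
  nbhs p [set q | forall i, i \in s -> A i q].
Proof.
elim: s => [|i s IHs] nA; first by apply: filterS filterT => q _ i.
have /IHs ns : forall j, j \in s -> nbhs p (A j).
  by move=> j js; apply: nA; rewrite inE js orbT.
apply: filterS2 (nA i (mem_head _ _)) ns => q Aiq sq j.
by rewrite inE => /predU1P[->//|]; exact: sq.
Qed.

Section pointwise_convergence.
Variables (I : eqType) (T : topologicalType).
Implicit Types f g : {ptws I -> T}.

Lemma ptws_eval_continuous (i : I) :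
  continuous (fun f : {ptws I -> T} => f i).
Proof. exact: (@proj_continuous I (fun=> T) i). Qed.

Lemma ptws_nbhsP f (A : set {ptws I -> T}) : nbhs f A ->
  exists s : seq I, exists2 W : I -> set T, (forall i, nbhs (f i) (W i)) &
    [set g : {ptws I -> T} | forall i, i \in s -> W i (g i)] `<=` A.
Proof.
pose F : set_system (I -> T) := [set A | exists s : seq I,
  exists2 W : I -> set T, (forall i, nbhs (f i) (W i)) &
    [set g : {ptws I -> T} | forall i, i \in s -> W i (g i)] `<=` A].
have FF : Filter F.
  split.
  - by exists [::], (fun=> setT) => // i; exact: filterT.
  - move=> P Q [s [W nW WP]] [t [W' nW' WQ]].
    exists (s ++ t), (fun i => W i `&` W' i); first by move=> i; exact: filterI.
    move=> g /= gst; split.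
      by apply: WP => i si; have [|//] := gst i; rewrite mem_cat si.
    by apply: WQ => i si; have [|//] := gst i; rewrite mem_cat si orbT.
  - move=> P Q PQ [s [W nW WP]]; exists s, W => //.
    exact: subset_trans PQ.
(* The product topology is the supremum of the initial topologies of the projections, so convergence
   of [F] to [f] can be checked on one coordinate at a time. *)
suff : F --> f by exact.
apply/cvg_sup => i B [_ [[C oC <-] Cfi] CB].
exists [:: i], (fun j => if j == i then C else setT).
  move=> j; case: eqP => [->|_]; last exact: filterT.
  exact: open_nbhs_nbhs.
by move=> g /(_ i); rewrite mem_head eqxx => /(_ isT) Cgi; exact: CB.
Qed.

End pointwise_convergence.

Section Cp_nbhs.
Variables (X E : topologicalType).

Lemma Cp_eval_continuous (x : X) :
  continuous (fun f : Cp X E => (f : continuousType X E) x).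
Proof.
move=> f; apply: (@continuous_comp (Cp X E) {ptws X -> E} E
  (fun f : Cp X E => (f : continuousType X E) : {ptws X -> E}) (fun g => g x)).
  exact: initial_continuous.
exact: ptws_eval_continuous.
Qed.

Lemma Cp_nbhs_box (f : Cp X E) (s : seq X) (W : X -> set E) :
  (forall x, x \in s -> nbhs ((f : continuousType X E) x) (W x)) ->
  nbhs f [set g : Cp X E |
           forall x, x \in s -> W x ((g : continuousType X E) x)].
Proof.
by move=> nW; apply: near_all => x xs; apply: Cp_eval_continuous; exact: nW.
Qed.

Lemma Cp_nbhsP (f : Cp X E) (A : set (Cp X E)) : nbhs f A ->
  exists s : seq X, exists2 W : X -> set E,
    (forall x, nbhs ((f : continuousType X E) x) (W x)) &
    [set g : Cp X E | forall x, x \in s ->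
       W x ((g : continuousType X E) x)] `<=` A.
Proof.
move=> [_ [[B oB <-] Bf] BA].
have /ptws_nbhsP[s [W nW WB]] :
    nbhs ((f : continuousType X E) : {ptws X -> E}) B.
  exact: open_nbhs_nbhs.
by exists s, W => // g gW; apply: BA; exact: WB.
Qed.

Lemma dense_CpP (D : set (Cp X E)) :
  (forall (f : Cp X E) (s : seq X) (W : X -> set E),
     (forall x, nbhs ((f : continuousType X E) x) (W x)) ->
     exists2 g : Cp X E, D g &
       forall x, x \in s -> W x ((g : continuousType X E) x)) <-> dense D.
Proof.
split=> [DP U [f Uf] oU | dD f s W nW].
  have /Cp_nbhsP[s [W nW WU]] : nbhs f U by exact: open_nbhs_nbhs.
  have [g Dg gW] := DP f s W nW.
  by exists g; split => //; exact: WU.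
have nf := @Cp_nbhs_box f s W (fun x _ => nW x).
have [|g [+ Dg]] := dD _ _ (open_interior [set g : Cp X E |
           forall x, x \in s -> W x ((g : continuousType X E) x)]).
  by exists f.
by move=> /interior_subset gW; exists g.
Qed.

End Cp_nbhs.

(** * Clopen sets and finite interpolation by continuous functions *)

Lemma clopen_near_const (X : topologicalType) (K : set X) (x : X) :
  clopen K -> nbhs x [set y | `[< K y >] = `[< K x >]].
Proof.
move=> [oK cK]; case: asboolP => Kx.
  have : nbhs x K by exact: open_nbhs_nbhs.
  by apply: filterS => y Ky; rewrite /= asboolT.
have : nbhs x (~` K).
  by apply: open_nbhs_nbhs; split => //; exact: closed_openC.
by apply: filterS => y Ky; rewrite /= asboolF.
Qed.

Section interpolation.
Variables (X E : topologicalType).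

Lemma clopen_base_nbhs (x : X) (A : set X) : has_clopen_base X -> nbhs x A ->
  exists2 P, clopen P & P x /\ P `<=` A.
Proof.
move=> [B Bc [_ Bb]] /Bb[P [BP Px] PA].
by exists P => //; exact: Bc.
Qed.

Lemma continuous_if_clopen (P : set X) (f g : X -> E) :
  clopen P -> continuous f -> continuous g ->
  continuous (fun x => if `[< P x >] then f x else g x).
Proof.
move=> [oP cP] cf cg x A /=; case: asboolP => Px nA.
  have nP : nbhs x P by exact: open_nbhs_nbhs.
  apply: filterS2 nP (cf x A nA) => y Py Ay.
  by rewrite /= asboolT.
have nP : nbhs x (~` P).
  by apply: open_nbhs_nbhs; split => //; exact: closed_openC.
apply: filterS2 nP (cg x A nA) => y Py Ay.
by rewrite /= asboolF.
Qed.

(** Start from the constant [e] and, for each new point [x], set the value to [v x] on a clopen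
    neighbourhood of [x] inside [N x] that misses the other points. The second clause says where
    values other than [e] can occur, which keeps preimages small. *)
Lemma Cp_interpolation (e : E) (v : X -> E) (N : X -> set X) (s : seq X) :
  accessible_space X -> has_clopen_base X ->
  (forall x, x \in s -> nbhs x (N x)) ->
  exists2 g : continuousType X E, (forall x, x \in s -> g x = v x) &
    forall y, g y = e \/ exists2 x, x \in s & N x y /\ g y = v x.
Proof.
move=> T1 zX; elim: s => [|x s IHs] nN.
  by exists (cst e) => // y; left.
have [|g gs gN] := IHs.
  by move=> y ys; apply: nN; rewrite inE ys orbT.
(* The guard [z <> x] allows [x] to occur again in [s]. *)
have nx : nbhs x (N x `&` [set y | forall z, z \in s -> z <> x -> z <> y]).
  apply: filterI; first by apply: nN; rewrite mem_head.
  apply: near_all => z zs; have [->|] := eqVneq x z.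
    exact: filterS filterT.
  move=> /T1[U [oU xU /set_mem zU]]; apply: (@filterS _ _ _ U).
    by move=> y Uy _ zy; apply: zU; rewrite zy.
  by apply: open_nbhs_nbhs; split => //; exact: set_mem.
have [P cP [Px PN]] := clopen_base_nbhs zX nx.
have ch := continuous_if_clopen cP (@cst_continuous X E (v x))
  (@cts_fun _ _ g).
exists (mkcts ch) => [y | y]; rewrite /= /mkcts.
  rewrite inE => /predU1P[->|ys]; first by rewrite asboolT.
  case: asboolP => [Py|_]; last exact: gs.
  have [->//|yx] := pselect (y = x).
  by have [_ /(_ y ys yx)] := PN y Py.
case: asboolP => [Py|_].
  by right; exists x; [rewrite mem_head|have [] := PN y Py].
case: (gN y) => [->|[z zs zN]]; first by left.
by right; exists z => //; rewrite inE zs orbT.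
Qed.

End interpolation.

(** * From M-separability of the function space to Menger powers *)

Lemma S_separable_M_separable (Z : topologicalType) :
  S_separable Z -> M_separable Z.
Proof.
move=> SZ Y dY; have [F [FY FG]] := SZ Y dY; exists F; split => // U U0 oU.
have [|V ->//|n /(_ U erefl)[f [Uf Ff]]] := FG [set U].
  exact: finite_set1.
by exists f; split => //; exists n.
Qed.

Section M_separable_Cp.
Variables (X E : topologicalType) (W : set E) (a b : E).
Hypotheses (T1 : accessible_space X) (zX : has_clopen_base X).
Hypotheses (oW : open W) (Wa : W a) (Wb : ~ W b).
Hypothesis MX : M_separable (Cp X E).

Let covered (n : nat) (U : set (set {ptws 'I_n -> X})) (f : Cp X E)
    (V : set (set {ptws 'I_n -> X})) :=
  [/\ finite_set V, V `<=` U &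
    forall p : {ptws 'I_n -> X},
      (forall i, W ((f : continuousType X E) (p i))) -> exists2 A, V A & A p].

(** Given [f] and a finite [s], let [t] list the points of [s] that [f] sends into [W]. Interpolate
    [f] on [s] with default value [b], outside [W], so that the preimage of [W] stays close to [t].
    Each of the finitely many [n]-tuples from [t] has a box inside a member of [U], and these
    members suffice. *)
Lemma dense_covered (n : nat) (U : set (set {ptws 'I_n -> X})) :
  open_cover U -> dense [set f | exists V, covered U f V].
Proof.
move=> [oU cU]; apply/dense_CpP => f s N nN.
have box_ex (p : {ptws 'I_n -> X}) :
    exists CB : set {ptws 'I_n -> X} * ('I_n -> set X),
    [/\ U CB.1, forall i, nbhs (p i) (CB.2 i) &
      [set q : {ptws 'I_n -> X} | forall i, CB.2 i (q i)] `<=` CB.1].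
  have : setT p by [].
  rewrite -cU => -[C UC Cp]; have oC := oU _ UC.
  have /ptws_nbhsP[t [B nB BC]] : nbhs p C by exact: open_nbhs_nbhs.
  by exists (C, B); split => //= q Bq; apply: BC => i _; exact: Bq.
have {box_ex}[CB CBP] := choice box_ex.
pose t := [seq x <- s | `[< W ((f : continuousType X E) x) >]].
pose tup (q : {ffun 'I_n -> 'I_(size t)}) : {ptws 'I_n -> X} :=
  fun i => tnth (in_tuple t) (q i).
(* [M x] is the intersection of the sides at [x] of all the boxes, over every tuple and every
   coordinate where the tuple takes the value [x]. *)
pose M x := [set y | forall q, q \in enum {ffun 'I_n -> 'I_(size t)} ->
  forall i, i \in enum 'I_n -> tup q i = x -> (CB (tup q)).2 i y].
have nM x : x \in s -> nbhs x (M x).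
  move=> _; apply: near_all => q _; apply: near_all => i _.
  have [<-|qx] := eqVneq (tup q i) x.
    by have [_ nB _] := CBP (tup q); apply: filterS (nB i).
  by apply: filterS filterT => y _ /eqP; rewrite (negbTE qx).
have [g gs gM] := Cp_interpolation b (f : continuousType X E) T1 zX nM.
exists g; last by move=> x xs; rewrite gs //; exact: nbhs_singleton.
exists [set (CB (tup q)).1 | q in setT]; split.
- exact/finite_image/finite_finset.
- by move=> _ [q _ <-]; have [] := CBP (tup q).
move=> p Wp.
have /choice[q qP] i : exists j : 'I_(size t), M (tnth (in_tuple t) j) (p i).
  have [gb|[x xs [Mx gx]]] := gM (p i); first by have := Wp i; rewrite gb.
  have xt : x \in t.
    by rewrite mem_filter xs andbT; apply/asboolP; rewrite -gx; exact: Wp.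
  have /seq_tnthP[j xj] := xt.
  by exists j; rewrite -xj.
exists (CB (tup (finfun q))).1; first by exists (finfun q).
have [_ _] := CBP (tup (finfun q)); apply => i /=.
by apply: (qP i); rewrite ?mem_enum// /tup ffunE.
Qed.

Lemma M_separable_Cp_menger (n : nat) : menger {ptws 'I_n -> X}.
Proof.
move=> U cU; have [F [FY dF]] := MX (fun k => dense_covered (cU k)).
have V_ex (kf : nat * Cp X E) : exists V,
    F kf.1 kf.2 -> covered (U kf.1) kf.2 V.
  have [Ff|nFf] := pselect (F kf.1 kf.2); last by exists set0.
  by have [V cV] := (FY kf.1).2 kf.2 Ff; exists V.
have {V_ex}[V VP] := choice V_ex.
exists (fun k => \bigcup_(f in F k) V (k, f)); split => [k|].
  split; last by move=> A [f /(VP (k, f))[_ VU _]]; exact: VU.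
  apply: bigcup_finite; first exact: (FY k).1.
  by move=> f /(VP (k, f))[].
rewrite -subTset => p _.
pose B := [set f : Cp X E | forall i, i \in enum 'I_n ->
  W ((f : continuousType X E) (p i))].
have nB : nbhs (cst a : Cp X E) B.
  apply: near_all => i _; apply: (@Cp_eval_continuous X E (p i) (cst a)).
  exact: open_nbhs_nbhs.
have [|f [/interior_subset Bf [k _ Fkf]]] := dF _ _ (open_interior B).
  by exists (cst a : continuousType X E).
have [_ _ /(_ p)[i|A VA Ap]] := VP (k, f) Fkf.
  by apply: Bf; rewrite mem_enum.
by exists k => //; exists A => //; exists f.
Qed.

End M_separable_Cp.

(** * Coarser topologies with a countable base from countably many clopen sets *)

Lemma countable_enum (T : choiceType) (a : T) (A : set T) : countable A ->
  exists e : nat -> T, A `<=` range e /\ range e `<=` A `|` [set a].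
Proof.
move=> /countable_injP[c cinj].
pose e n := xget a [set x | A x /\ c x = n].
exists e; split => [x Ax|_ [n _ <-]]; last first.
  by rewrite /e; case: xgetP => [x _ []|]; [left|right].
exists (c x) => //.
have [Ae ce] : A (e (c x)) /\ c (e (c x)) = c x.
  by apply: (@xgetPex _ _ [set y | A y /\ c y = c x]); exists x.
by apply: cinj => //; exact: mem_set.
Qed.

Section initial_cantor.
Variables (X : topologicalType) (K : nat -> set X).

(** The map into the Cantor space whose coordinates are the characteristic functions of the sets
    [K n]; its initial topology is the coarser topology sought. *)
Definition itinerary (x : X) : {ptws nat -> bool} := fun n => `[< K n x >].

Definition itinerary_topology : topologicalType := initial_topology itinerary.

Lemma nbhs_itinerary (x : itinerary_topology) (s : seq nat) :
  nbhs x [set y : itinerary_topology |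
           forall n, n \in s -> itinerary y n = itinerary x n].
Proof.
apply: near_all => n _.
have : continuous (fun y : itinerary_topology => itinerary y n).
  move=> y; apply: (@continuous_comp _ {ptws nat -> bool} bool
    (itinerary : itinerary_topology -> _) (fun g => g n)).
    exact: initial_continuous.
  exact: ptws_eval_continuous.
by move=> /(_ x [set itinerary x n]); apply; exact: discrete_set1.
Qed.

Lemma itinerary_nbhsP (x : itinerary_topology) (A : set itinerary_topology) :
  nbhs x A -> exists N, [set y : itinerary_topology |
    forall n, (n < N)%N -> itinerary y n = itinerary x n] `<=` A.
Proof.
move=> [_ [[B oB <-] Bx] BA].
have /ptws_nbhsP[s [W nW WB]] : nbhs (itinerary x) B by exact: open_nbhs_nbhs.
exists (\max_(i <- s) i).+1 => y yx; apply: BA; apply: WB => i si.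
rewrite yx; first exact: nbhs_singleton.
by rewrite ltnS; apply: leq_bigmax_seq.
Qed.

(** The cylinders over finite binary words form a base, and there are countably many words. *)
Lemma itinerary_second_countable : @second_countable itinerary_topology.
Proof.
pose C (w : seq bool) := [set y : itinerary_topology |
  forall n, n \in iota 0 (size w) -> itinerary y n = nth false w n].
exists (range C).
  by apply: (card_le_trans (card_image_le C setT)); exact: countableP.
split.
  move=> _ [w _ <-]; rewrite openE => x xw.
  apply: filterS (nbhs_itinerary x (iota 0 (size w))) => y yx n nw.
  by rewrite yx // xw.
move=> x A /itinerary_nbhsP[N NA].
pose w := mkseq (itinerary x) N.
exists (C w).
  split; first by exists w.
  by move=> n; rewrite mem_iota size_mkseq => /andP[_ nN]; rewrite nth_mkseq.
move=> y yw; apply: NA => n nN; rewrite yw ?nth_mkseq//.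
by rewrite mem_iota size_mkseq.
Qed.

Hypothesis cK : forall n, clopen (K n).

Lemma itinerary_open (A : set X) :
  @open itinerary_topology A -> @open X A.
Proof.
rewrite !openE => oA x Ax; have /itinerary_nbhsP[N NA] := oA x Ax.
suff : nbhs x [set y | forall n, n \in iota 0 N ->
    itinerary y n = itinerary x n].
  by apply: filterS => y yx; apply: NA => n nN; apply: yx; rewrite mem_iota.
by apply: near_all => n _; exact: clopen_near_const.
Qed.

Hypothesis sepK : forall x y, x <> y -> exists n, ~ (K n x <-> K n y).

Lemma itinerary_hausdorff : hausdorff_space itinerary_topology.
Proof.
move=> x y xy; apply: contrapT => /sepK[n]; apply.
have [z []] := xy _ _ (nbhs_itinerary x [:: n]) (nbhs_itinerary y [:: n]).
move=> /(_ n (mem_head _ _)) zx /(_ n (mem_head _ _)).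
by rewrite zx => /(congr1 is_true); rewrite /itinerary !asboolE => ->.
Qed.

Lemma iw_eq_omega_clopen (R : realType) : iw_eq_omega X.
Proof.
exists (Topological.class itinerary_topology); split.
- exact: itinerary_open.
- split; first exact: itinerary_hausdorff.
  (* The initial topology of a map into a uniform space is uniform, hence completely regular. *)
  exact: (@uniform_completely_regular R (initial_topology itinerary)).
- exact: itinerary_second_countable.
Qed.

End initial_cantor.

Lemma M_separable_Cp_iw (R : realType) (X E : topologicalType) (W : set E)
    (a b : E) :
  accessible_space X -> has_clopen_base X -> clopen W -> W a -> ~ W b ->
  M_separable (Cp X E) -> iw_eq_omega X.
Proof.
move=> T1 zX [oW cW] Wa Wb MX.
have dT (Z : topologicalType) : dense [set: Z].
  by move=> U [f Uf] _; exists f.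
(* On the constant sequence of the whole space, M-separability yields a countable dense set of
   functions. *)
have [F [FY dF]] := MX (fun=> setT) (fun=> dT _).
have /(countable_enum (cst a : continuousType X E))[e [De _]] :
    countable (\bigcup_n F n).
  by apply: bigcup_countable => // n _; exact/finite_set_countable/(FY n).1.
apply: (@iw_eq_omega_clopen _ (fun n => e n @^-1` W) _ _ R).
  by move=> n; apply: preimage_clopen; [split|exact: cts_fun].
move=> x y xy.
(* [g] sends [x] into [W] and [y] outside. Since [W] is clopen, this persists near [g], hence holds
   for some [e n]. *)
have [g gs _] := @Cp_interpolation X E b
  (fun z => if `[< z = x >] then a else b)
  (fun=> setT) [:: x; y] T1 zX (fun _ _ => filterT).
pose V z := if `[< z = x >] then W else ~` W.
have [|d [/interior_subset dP Fd]] := dF _ _ (open_interior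
    [set f : Cp X E | forall z, z \in [:: x; y] ->
      V z ((f : continuousType X E) z)]).
  exists g; apply: (@Cp_nbhs_box X E g _ V) => z zs.
  rewrite /V gs//; case: asboolP => _.
    exact: open_nbhs_nbhs.
  by apply: open_nbhs_nbhs; split => //; exact: closed_openC.
have [n _ en] := De d Fd.
exists n; rewrite en /= => -[xW _]; move: dP; rewrite /V => dP.
have := dP x; rewrite mem_head asboolT// => /(_ isT) /xW.
have := dP y; rewrite !inE eqxx orbT asboolF => [/(_ isT)//|].
by move=> yx; apply: xy.
Qed.

(** * Countable clopen separation from a Menger square *)

Section clopen_separation.
Variable X : topologicalType.

(* The sets [C `*` ~` C] with [C] clopen cover the complement of the diagonal,
   hence the closed set [F `*` G]. *)
Lemma menger_countable_separation (F G : set X) :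
  accessible_space X -> has_clopen_base X -> menger {ptws 'I_2 -> X} ->
  closed F -> closed G -> F `&` G = set0 ->
  exists K : set (set X), [/\ countable K, K `<=` clopen &
    forall x y, F x -> G y -> exists2 C, K C & C x /\ ~ C y].
Proof.
move=> T1 zX mX cF cG FG.
pose sq (C : set X) : set {ptws 'I_2 -> X} :=
  [set p | C (p ord0) /\ ~ C (p ord_max)].
pose D : set {ptws 'I_2 -> X} :=
  [set p | ~ (F (p ord0) /\ G (p ord_max))].
pose U : set (set {ptws 'I_2 -> X}) :=
  [set A | A = D \/ exists2 C, clopen C & A = sq C].
have op0 i (A : set X) : open A -> open [set p : {ptws 'I_2 -> X} | A (p i)].
  by move=> oA; apply: open_comp => // p _; exact: ptws_eval_continuous.
have oU A : U A -> open A.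
  move=> [->|[C [oC cC] ->]].
    rewrite (_ : D = [set p : {ptws 'I_2 -> X} | (~` F) (p ord0)] `|`
                           [set p | (~` G) (p ord_max)]).
      by apply: openU; [apply: (op0 _ (~` F))|apply: (op0 _ (~` G))];
        exact: closed_openC.
    by apply/seteqP; split=> p /=; [move/not_andP|move=> ?; exact/not_andP].
  by apply: openI; [exact: op0|apply: (op0 _ (~` C)); exact: closed_openC].
have cU : \bigcup_(A in U) A = setT.
  rewrite -subTset => p _.
  have [[Fp Gp]|nFG] := pselect (F (p ord0) /\ G (p ord_max)); last first.
    by exists D => //; left.
  have [|V [oV /set_mem Vp /set_mem nVp]] := T1 (p ord0) (p ord_max).
    apply/eqP => pp; have : (F `&` G) (p ord0) by split => //; rewrite pp.
    by rewrite FG.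
  have [|P cP [Pp PV]] := clopen_base_nbhs (A := V) (x := p ord0) zX.
    exact: open_nbhs_nbhs.
  by exists (sq P); [right; exists P|split => // /PV].
(* The Menger property for a constant sequence of covers gives a countable subcover. *)
have [V [VU cV]] := mX (fun=> U) (fun=> conj oU cU).
have C_ex (A : set {ptws 'I_2 -> X}) : exists C : set X,
    clopen C /\ ((exists2 C, clopen C & A = sq C) -> A = sq C).
  have [[C cC AC]|nA] := pselect (exists2 C, clopen C & A = sq C).
    by exists C.
  by exists set0; split => //; exact: clopen0.
have {C_ex}[C CP] := choice C_ex.
exists (C @` \bigcup_n V n); split.
- apply: (card_le_trans (card_image_le C _)).
  by apply: bigcup_countable => // n _; exact/finite_set_countable/(VU n).1.
- by move=> _ [A _ <-]; exact: (CP A).1.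
move=> x y Fx Gy.
pose p : {ptws 'I_2 -> X} := fun i => if i == ord0 then x else y.
have : setT p by [].
rewrite -cV => -[n _ [A VA Ap]].
exists (C A); first by exists A => //; exists n.
have [Aq|UA] := (VU n).2 A VA.
  by exfalso; move: Ap; rewrite Aq; apply; split.
by move: Ap; rewrite {1}((CP A).2 UA).
Qed.

(** Let [B] be a countable base of the coarser topology. For [P] and [Q] in [B] with the closure of
    [P] inside [Q], this closure and the complement of [Q] are disjoint closed sets, separated by
    countably many clopen sets. By regularity every two distinct points are handled by one of these
    countably many pairs. *)
Lemma countable_clopen_separation (R : realType) :
  accessible_space X -> has_clopen_base X -> iw_eq_omega X ->
  menger {ptws 'I_2 -> X} ->
  exists K : nat -> set X, (forall n, clopen (K n)) /\
    forall x y, x <> y -> exists n, K n x /\ ~ K n y.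
Proof.
move=> T1 zX [t [tX [t2 tcr] [B Bcount [Bo Bb]]]] mX.
pose X' := Topological.Pack t.
have oc (A : set X) : @closed X' A -> @closed X A.
  rewrite -(@openC X') => /tX; rewrite -(@openC X).
  by [].
have K_ex (PQ : set X * set X) : exists K : set (set X),
    [/\ countable K, K `<=` @clopen X &
    B PQ.2 -> @closure X' PQ.1 `<=` PQ.2 ->
    forall x y, @closure X' PQ.1 x -> ~ PQ.2 y ->
      exists2 C, K C & C x /\ ~ C y].
  have [[BQ PQsub]|nBQ] := pselect (B PQ.2 /\ @closure X' PQ.1 `<=` PQ.2);
    last first.
    by exists set0; split => // bb cc; case: nBQ.
  have [|||K [cK Kc KP]] :=
    @menger_countable_separation (@closure X' PQ.1) (~` PQ.2) T1 zX mX.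
  - by apply: oc; exact: (@closed_closure X').
  - by apply: open_closedC; apply: tX; exact: Bo.
  - by apply/disjoints_subset; rewrite setCK.
  by exists K.
have {K_ex}[K KP] := choice K_ex.
(* The default [setT] is clopen, so the enumeration consists of clopen sets. *)
have [|e [Le eL]] := @countable_enum (set X) setT
    (\bigcup_(PQ in B `*` B) K PQ).
  apply: bigcup_countable; first exact: countableX.
  by move=> PQ _; have [] := KP PQ.
exists e; split.
  move=> n; have [|[PQ _]|->] := eL (e n); first by exists n.
    by have [_ KPQ _] := KP PQ; exact: KPQ.
  exact: clopenT.
move=> x y xy.
have [|V [oV /set_mem Vx /set_mem nVy]] := @hausdorff_accessible X' t2 x y.
  exact/eqP.
have [|Q [BQ Qx] QV] := Bb x V; first exact: (@open_nbhs_nbhs X').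
have [|N nN NQ] := @completely_regular_regular R X' tcr x Q.
  by apply: (@open_nbhs_nbhs X'); split => //; exact: Bo.
have [P [BP Px] PN] := Bb x N nN.
have clPQ : @closure X' P `<=` Q.
  by apply: subset_trans NQ; exact: (@closure_subset X').
have [_ _ /(_ BQ clPQ x y)[||C KC Cxy]] := KP (P, Q).
- exact: (@subset_closure X').
- by move=> /QV.
have [|n _ en] := Le C; first by exists (P, Q).
by exists n; rewrite en.
Qed.

End clopen_separation.

(** * A countable family of locally constant functions *)

Section exact_interpolation.
Variables (X E : topologicalType) (K : nat -> set X) (val : nat -> E).
Hypothesis cK : forall n, clopen (K n).

Definition itin (N : nat) (x : X) : N.-tuple bool :=
  [tuple `[< K n x >] | n < N].

(** Values are coded by numbers through [val], so that the index type is countable. *)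
Definition simple (i : {N : nat & {ffun N.-tuple bool -> nat}}) (x : X) : E :=
  val (tagged i (itin (tag i) x)).

Lemma simple_continuous i : continuous (simple i).
Proof.
move=> x A nA; rewrite /simple.
have : nbhs x [set y | forall n : 'I_(tag i), n \in enum 'I_(tag i) ->
    `[< K n y >] = `[< K n x >]].
  by apply: near_all => n _; exact: clopen_near_const.
apply: filterS => y yx /=.
suff -> : itin (tag i) y = itin (tag i) x by exact: nbhs_singleton nA.
by apply: eq_from_tnth => n; rewrite !tnth_mktuple yx ?mem_enum.
Qed.

Hypothesis sepK : forall x y, x <> y -> exists n, K n x /\ ~ K n y.
Hypothesis val_surj : forall e, exists n, val n = e.

(** A length [N] beyond the separating indices of all pairs from [s] gives distinct points of [s]
    distinct words [itin N x]; any values can then be prescribed on these words. *)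
Lemma simple_interpolation (f : X -> E) (s : seq X) :
  exists i, forall x, x \in s -> simple i x = f x.
Proof.
have sep_ex (xy : X * X) : exists n, xy.1 <> xy.2 -> K n xy.1 /\ ~ K n xy.2.
  have [/sepK[n Kn]|xy12] := pselect (xy.1 <> xy.2); first by exists n.
  by exists 0%N.
have {sep_ex}[m mP] := choice sep_ex.
pose N := (\max_(x <- s) \max_(y <- s) m (x, y)).+1.
have itin_inj x y : x \in s -> y \in s -> itin N x = itin N y -> x = y.
  move=> xs ys exy; apply: contrapT => /(mP (x, y))/= [Kx nKy].
  have mN : (m (x, y) < N)%N.
    rewrite ltnS (leq_trans _ (leq_bigmax_seq x xs _))//.
    exact: (leq_bigmax_seq y).
  have := congr1 (fun t => tnth t (Ordinal mN)) exy.
  by rewrite !tnth_mktuple /= asboolT// asboolF.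
have phi_ex (w : N.-tuple bool) : exists k, forall x, x \in s -> itin N x = w ->
    val k = f x.
  have [[x [xs xw]]|nx] := pselect (exists x, x \in s /\ itin N x = w).
    have [k vk] := val_surj (f x); exists k => y ys yw.
    by rewrite vk; congr f; apply: itin_inj => //; rewrite xw.
  by exists 0%N => x xs xw; case: nx; exists x.
have [phi phiP] := choice phi_ex.
exists (Tagged (fun N => {ffun N.-tuple bool -> nat}) (finfun phi)) => x xs.
by rewrite /simple /= ffunE; exact: phiP.
Qed.

End exact_interpolation.

(** * From Menger powers to S-separability *)

Section S_separable_Cp.
Variables (R : realType) (X E : topologicalType) (h : E -> R).
Hypothesis h_continuous : continuous h.
(** With continuity, [E] carries the topology induced by [h]. The radii are indexed by natural
    numbers so that there are only countably many precisions. *)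
Hypothesis h_nbhs : forall v (A : set E), nbhs v A ->
  exists e : nat, [set w | `|h w - h v| < e.+1%:R^-1] `<=` A.
Variables (I : countType) (d : I -> continuousType X E).
Hypothesis dP : forall (f : X -> E) (s : seq X),
  exists i, forall x, x \in s -> d i x = f x.

(** Each choice [fs] of members of [Y n] defines the open set of points of the power where every
    [fs i], [i] in [ds], is close to [d i]. By density of [Y n] these sets cover the power, so its
    Menger property applies. *)
Lemma menger_simultaneous_approximation (k e : nat) (ds : seq I)
    (Y : nat -> set (Cp X E)) :
  menger {ptws 'I_k -> X} -> (forall n, dense (Y n)) ->
  exists G : nat -> set (Cp X E),
    (forall n, finite_set (G n) /\ G n `<=` Y n) /\
    forall p : {ptws 'I_k -> X}, exists n, forall i, i \in ds ->
      exists2 f, G n f & forall l,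
        `|h ((f : continuousType X E) (p l)) - h (d i (p l))| < e.+1%:R^-1.
Proof.
move=> mX dY.
pose A (fs : I -> Cp X E) : set {ptws 'I_k -> X} :=
  [set p | forall i, i \in ds -> forall l, l \in enum 'I_k ->
     `|h ((fs i : continuousType X E) (p l)) - h (d i (p l))| < e.+1%:R^-1].
pose U n : set (set {ptws 'I_k -> X}) :=
  [set A fs | fs in [set fs | forall i, Y n (fs i)]].
have oA fs : open (A fs).
  rewrite openE => p Ap; apply: near_all => i ids; apply: near_all => l lk.
  have ch (g : continuousType X E) :
      continuous (fun q : {ptws 'I_k -> X} => h (g (q l))).
    move=> q; apply: (@continuous_comp _ _ _
      (fun q : {ptws 'I_k -> X} => g (q l)) h); last exact: h_continuous.
    apply: (@continuous_comp _ _ _ (fun q : {ptws 'I_k -> X} => q l) g);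
      first exact: ptws_eval_continuous.
    exact: cts_fun.
  have cn : continuous (fun q : {ptws 'I_k -> X} =>
      `|h ((fs i : continuousType X E) (q l)) - h (d i (q l))|).
    move=> q; exact: (cvg_norm (cvgB (ch (fs i) q) (ch (d i) q))).
  by apply: (cvgr_lt _ (cn p)); exact: Ap.
have cU n : \bigcup_(B in U n) B = setT.
  rewrite -subTset => p _.
  have fs_ex i : exists f : Cp X E, Y n f /\ forall l,
      `|h ((f : continuousType X E) (p l)) - h (d i (p l))| < e.+1%:R^-1.
    have [|f Yf fd] := (dense_CpP (Y n)).2 (dY n) (d i) (codom p)
        (fun x => [set w | `|h w - h (d i x)| < e.+1%:R^-1]).
      move=> x; apply: cvgr_distC_lt; first exact: h_continuous.
      by rewrite invr_gt0.
    by exists f; split => // l; apply: fd; exact: codom_f.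
  have [fs fsP] := choice fs_ex.
  exists (A fs); first by exists fs => // i; exact: (fsP i).1.
  by move=> i _ l _; exact: (fsP i).2.
have [|V [VU cV]] := mX U.
  by move=> n; split => // _ [fs _ <-]; exact: oA.
have fs_ex (nB : nat * set {ptws 'I_k -> X}) : exists fs,
    V nB.1 nB.2 -> (forall i, Y nB.1 (fs i)) /\ A fs = nB.2.
  have [VB|nVB] := pselect (V nB.1 nB.2); last by exists d.
  by have [fs Yfs AB] := (VU nB.1).2 _ VB; exists fs.
have {fs_ex}[fs fsP] := choice fs_ex.
(* Only the values of [fs] on the finite list [ds] are kept, which makes each stage finite. *)
exists (fun n => \bigcup_(B in V n) (fs (n, B) @` [set` ds])); split.
  move=> n; split.
    by apply: bigcup_finite => [|B _]; [exact: (VU n).1|exact: finite_image].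
  by move=> _ [B VB [i _ <-]]; exact: ((fsP (n, B) VB).1 i).
move=> p; have : setT p by [].
rewrite -cV => -[n _ [B VB Bp]]; exists n => i ids.
exists (fs (n, B) i); first by exists B => //; exists i.
have [_ /= AB] := fsP (n, B) VB.
have AfsP : A (fs (n, B)) p by rewrite AB.
by move=> l; apply: AfsP; rewrite ?mem_enum.
Qed.

(* Every nonempty open set contains one of the functions [d i], so a finite
   family of nonempty open sets is met as soon as finitely many of the [d i] are
   simultaneously approximated; there are countably many such tasks, and each of
   them gets its own tail of the sequence [Y]. *)
Lemma menger_S_separable_Cp :
  (forall k, menger {ptws 'I_k -> X}) -> S_separable (Cp X E).
Proof.
move=> mX Y dY.
have G_ex (j : seq I * nat * nat) := menger_simultaneous_approximation j.2 j.1.1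
  (mX j.1.2) (fun n => dY (n + pickle j)%N).
have {G_ex}[G GP] := choice G_ex.
(* Index [m] is stage [m - pickle j] of task [j]. Only tasks with code at most [m] have started, and
   these are finitely many. *)
exists (fun m =>
  \bigcup_(j in [set j | (pickle j <= m)%N]) G j (m - pickle j)%N).
split=> [m|O finO OP].
  split.
    apply: bigcup_finite; last by move=> j _; exact: ((GP j).1 _).1.
    have -> : [set j : seq I * nat * nat | (pickle j <= m)%N] =
        pickle @^-1` `I_m.+1.
      by [].
    apply: finite_preimage; last exact: finite_II.
    by move=> j j' _ _; exact: (pcan_inj pickleK).
  move=> f [j /= jm]; move/((GP j).1 _).2.
  by rewrite subnK.
have [[U0 OU0]|nO] := pselect (exists U, O U); last first.
  by exists 0%N => U OU; case: nO; exists U.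
have [_ [f0 _]] := OP U0 OU0.
(* [i0] is a default index for the sets outside [O]. *)
have [i0 _] := dP (f0 : continuousType X E) [::].
have U_ex (U : set (Cp X E)) : exists j : seq X * nat * I, O U ->
    forall f : Cp X E, (forall x, x \in j.1.1 ->
      `|h ((f : continuousType X E) x) - h (d j.2 x)| < j.1.2.+1%:R^-1) ->
    U f.
  have [OU|nOU] := pselect (O U); last by exists ([::], 0%N, i0).
  have [oU [f Uf]] := OP U OU.
  have /Cp_nbhsP[s [W nW WU]] : nbhs f U by exact: open_nbhs_nbhs.
  have [e eP] := choice (fun x => h_nbhs (nW x)).
  have [i di] := dP (f : continuousType X E) s.
  exists (s, \max_(x <- s) e x, i) => _ g gd; apply: WU => x xs.
  apply: eP; rewrite /= -di//; apply: lt_le_trans (gd x xs) _.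
  rewrite lef_pV2 ?posrE// ler_nat ltnS.
  exact: leq_bigmax_seq.
have {U_ex}[j jP] := choice U_ex.
have /finite_seqP[us Ous] := finO.
(* A single task serves all of [O]: the points for all its members form one tuple, and the largest
   [e] gives the smallest radius. *)
pose t := flatten [seq (j U).1.1 | U <- us].
pose e := \max_(U <- us) (j U).1.2.
pose J := ([seq (j U).2 | U <- us], size t, e).
have [_ GJ] := GP J.
have [n nP] := GJ (tnth (in_tuple t)).
exists (n + pickle J)%N => U OU.
have Uus : U \in us by move: OU; rewrite Ous.
have [|f Gf fd] := nP (j U).2; first exact: map_f.
exists f; split; last by exists J; rewrite /= ?leq_addl ?addnK.
apply: jP => // x xj.
have /seq_tnthP[l ->] : x \in t.
  by apply/flattenP; exists (j U).1.1 => //;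
    exact: (map_f (fun U => (j U).1.1)).
apply: lt_le_trans (fd l) _; rewrite lef_pV2 ?posrE// ler_nat ltnS.
exact: (leq_bigmax_seq U).
Qed.

End S_separable_Cp.

(** * The target spaces and the equivalence *)

Lemma initial_nbhs_dist (R : realType) (S : choiceType) (f : S -> R)
    (v : initial_topology f) (A : set (initial_topology f)) : nbhs v A ->
  exists e : nat, [set w | `|f w - f v| < e.+1%:R^-1] `<=` A.
Proof.
move=> [_ [[B oB <-] Bv] BA].
have /nbhs_ballP[r /= r0 rB] : nbhs (f v) B by exact: open_nbhs_nbhs.
have [e er] : exists e : nat, e.+1%:R^-1 < r.
  have [N _ /(_ N (leqnn N)) Nr] := near_infty_natSinv_lt (PosNum r0).
  by exists N.
exists e => w wv; apply/BA/rB; rewrite -ball_normE /= distrC.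
exact: lt_trans wv er.
Qed.

(** Since [f] omits the value [c], the strict and the weak inequality define the same set. *)
Lemma clopen_cut (R : realType) (S : choiceType) (f : S -> R) (c : R) :
  (forall x, f x <> c) -> clopen [set x : initial_topology f | f x < c].
Proof.
move=> fc; have cf := @initial_continuous S R f; split.
  by apply: (open_comp (f := f : initial_topology f -> R)) (@open_lt R c)
    => ? _; exact: cf.
rewrite (_ : mkset _ = [set x | f x <= c]).
  by apply: (preimage_closed (f := f : initial_topology f -> R))
    (@closed_le R c).
apply/seteqP; split=> x /=; first exact: ltW.
by rewrite le_eqVlt => /predU1P[/fc|].
Qed.

Lemma menger_Cp_S_separable (R : realType) (X E : topologicalType) (h : E -> R)
    (val : nat -> E) : continuous h ->
  (forall v (A : set E), nbhs v A ->
     exists e : nat, [set w | `|h w - h v| < e.+1%:R^-1] `<=` A) ->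
  (forall v, exists n, val n = v) ->
  accessible_space X -> has_clopen_base X -> iw_eq_omega X ->
  (forall n, menger {ptws 'I_n -> X}) -> S_separable (Cp X E).
Proof.
move=> ch hE val_surj T1 zX iwX mX.
have [K [cK sepK]] := countable_clopen_separation R T1 zX iwX (mX 2%N).
apply: (menger_S_separable_Cp ch hE
  (d := fun i => mkcts (@simple_continuous X E K val cK i))) => // f s.
exact: simple_interpolation.
Qed.

Lemma unpickle_surj (T : countType) (x0 x : T) :
  exists n, odflt x0 (unpickle n) = x.
Proof. by exists (pickle x); rewrite pickleK. Qed.

Theorem corollary3p37 (R : realType) (X : topologicalType)
    (X_tychonoff : tychonoff_space X) (X_zero_dim : has_clopen_base X) :
  [<-> S_separable (Cp X (Qtop R));
       M_separable (Cp X (Qtop R));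
       S_separable (Cp X (Ztop R));
       M_separable (Cp X (Ztop R));
       S_separable (Cp X bool);
       M_separable (Cp X bool);
       iw_eq_omega X /\ forall n : nat, menger {ptws 'I_n -> X}].
Proof.
have T1 : accessible_space X := hausdorff_accessible X_tychonoff.1.
have M7 (E : topologicalType) (W : set E) (a b : E) :
    clopen W -> W a -> ~ W b -> M_separable (Cp X E) ->
    iw_eq_omega X /\ forall n : nat, menger {ptws 'I_n -> X}.
  move=> cW Wa Wb MX; split; first exact: (M_separable_Cp_iw R T1 _ cW Wa Wb).
  by move=> n; exact: (M_separable_Cp_menger T1 _ cW.1 Wa Wb).
(* The irrational [pi] cuts both the rationals and the integers into clopen parts, with 0 below and
   4 above. *)
have MQ7 := M7 (Qtop R) [set q | ratr q < pi :> R] 0 4.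
have MZ7 := M7 (Ztop R) [set z | intr z < pi :> R] 0 4.
have MB7 := M7 bool [set true] true false.
have SZ : iw_eq_omega X /\ (forall n : nat, menger {ptws 'I_n -> X}) ->
    S_separable (Cp X (Ztop R)).
  move=> [iwX mX].
  apply: (@menger_Cp_S_separable R X (Ztop R) intr
    (fun n => odflt 0 (@unpickle int n))) => //.
  - exact: initial_continuous.
  - exact: initial_nbhs_dist.
  - exact: unpickle_surj.
have SQ : iw_eq_omega X /\ (forall n : nat, menger {ptws 'I_n -> X}) ->
    S_separable (Cp X (Qtop R)).
  move=> [iwX mX].
  apply: (@menger_Cp_S_separable R X (Qtop R) ratr
    (fun n => odflt 0 (@unpickle rat n))) => //.
  - exact: initial_continuous.
  - exact: initial_nbhs_dist.
  - exact: unpickle_surj.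
have SB : iw_eq_omega X /\ (forall n : nat, menger {ptws 'I_n -> X}) ->
    S_separable (Cp X bool).
  move=> [iwX mX].
  apply: (@menger_Cp_S_separable R X bool (fun b => (b : nat)%:R)
    (fun n => odflt false (@unpickle bool n))) => //.
  - move=> v A /nbhs_singleton Av.
    apply: (@filterS bool (nbhs v) _ [set v]) => [w ->//|].
    exact: discrete_set1.
  (* For [e = 0] the radius is 1, exactly the distance between the images of the two booleans, so
     the strict inequality forces equality. *)
  - move=> v A /nbhs_singleton Av; exists 0%N => w.
    rewrite /= invr1; case: v w Av => -[]//=;
      by rewrite ?subr0 ?sub0r ?normrN normr1 ltxx.
  - exact: unpickle_surj.
have pi4 : ~ (4 < pi :> R) by have := pihalf_lt2 R; lra.
(* The cycle changes target space by passing through the last assertion, which each M-separability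
   implies and which implies each S-separability. *)
tfae.
- exact: S_separable_M_separable.
- move=> MQ; apply: SZ; apply: MQ7 MQ.
  + by apply: clopen_cut => q qpi; apply: (@pi_irrationnal R); exists q.
  + by rewrite /= raddf0 pi_gt0.
  + by rewrite /= ratr_nat.
- exact: S_separable_M_separable.
- move=> MZ; apply: SB; apply: MZ7 MZ.
  + apply: clopen_cut => z zpi; apply: (@pi_irrationnal R).
    by exists z%:~R; rewrite // ratr_int.
  + by rewrite /= mulr0z pi_gt0.
  + by [].
- exact: S_separable_M_separable.
- have cB : clopen [set true].
    by split; [exact: discrete_open|exact: discrete_closed].
  by move=> MB; exact: (MB7 cB erefl _ MB).
- exact: SQ.
Qed.
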